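(* For every positive integer $s$ and every $\tau>0$ there exist positive constants $C_9=C_9(\tau,s)$, $C_{10}=C_{10}(\tau,s)$ and $C_{11}=C_{11}(s)$ such that the following holds. Let $h>0$ and let $\mathcal{X}\subset(-\pi,\pi]$ form an $(h,\tau,s)$-cluster. Then for all integers $N\ge s$ with $Nh\le C_9$ we have $$C_{10}\,N^{1/2}(Nh)^{j-1}\ \le\ \sigma_j\bigl(\mathbf{V}_N(\mathcal{X})\bigr)\ \le\ C_{11}\,N^{1/2}(Nh)^{j-1},\qquad j=1,\dots,s.$$
   Context: Wrap-around distance: for $x,y\in\mathbb{R}$, $\Delta(x,y)=|\operatorname{Arg}(e^{\imath(x-y)})|\in[0,\pi]$, where $\operatorname{Arg}$ is the principal argument with values in $(-\pi,\pi]$. Cluster: a set of $s$ distinct nodes $\mathcal{X}=\{x_1,\dots,x_s\}\subset(-\pi,\pi]$ forms an $(h,\tau,s)$-cluster, for $\tau>0$, if $\tau h\le\Delta(x,y)\le h$ for all $x,y\in\mathcal{X}$, $x\ne y$. $\mathbf{V}_N(\mathcal{X})$ is the $(N+1)\times s$ Vandermonde matrix with entries $e^{\imath k x_j}$ ($k=0,\dots,N$, $j=1,\dots,s$). The singular values of a matrix $\mathbf{A}$ are listed in non-increasing order $\sigma_1(\mathbf{A})\ge\sigma_2(\mathbf{A})\ge\cdots$. *)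

(* Defs.v *)
From mathcomp Require Import all_boot all_order all_algebra.
From mathcomp Require Import complex.
From mathcomp Require Import boolp classical_sets reals trigo.

Set Implicit Arguments.
Unset Strict Implicit.
Unset Printing Implicit Defensive.

Import Order.TTheory GRing.Theory Num.Theory.
Local Open Scope ring_scope.
Local Open Scope complex_scope.
Local Open Scope sesquilinear_scope.

Definition expi (R : realType) (t : R) : R[i] := cos t +i* sin t.

(* The principal argument. For z != 0 the set below is a singleton; for z = 0
   it is the whole interval, so Arg 0 is an unspecified angle (Arg is only used
   on unimodular numbers). *)
Definition Arg (R : realType) (z : R[i]) : R :=
  xget 0 [set t : R | (- pi < t <= pi) /\ z = `|z| * expi t]%classic.

Definition wrap_dist (R : realType) (x y : R) : R := `|Arg (expi (x - y))|.

(* The set {x_1, ..., x_s} of s distinct nodes is given by an injective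
   enumeration. *)
Definition is_cluster (R : realType) (h tau : R) (s : nat) (x : 'I_s -> R)
    : Prop :=
  [/\ injective x,
      forall j, - pi < x j <= pi
    & forall j k, x j != x k -> tau * h <= wrap_dist (x j) (x k) <= h].

Definition vandermonde (R : realType) (N s : nat) (x : 'I_s -> R)
    : 'M[R[i]]_(N.+1, s) :=
  \matrix_(k < N.+1, j < s) expi (k%:R * x j).

(* Square roots of the eigenvalues of A^* A, counted with multiplicity, in
   non-increasing order; the eigenvalues are nonnegative reals of R[i], so
   taking their real part only changes their type. When m < n the list is the
   usual one padded with zeros. *)
Definition singular_values (R : realType) (m n : nat) (A : 'M[R[i]]_(m, n))
    : seq R :=
  sort >=%R [seq Num.sqrt (complex.Re (spectral_diag (A^t* *m A) 0 j))
            | j <- enum 'I_n].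

(* Singular values are numbered from 1. *)
Definition sigma (R : realType) (m n : nat) (j : nat) (A : 'M[R[i]]_(m, n))
    : R :=
  nth 0 (singular_values A) j.-1.

(* Main.v *)
(* Diagonalize V^* V in a unitary basis sorted by decreasing eigenvalues
   sigma_1^2 >= ... >= sigma_s^2, and put z_l = e^{i x_l}.

   Upper bound: some nonzero combination c of the first j eigenvectors
   annihilates (z_l / z_1 - 1)^m for all m < j - 1, so in (V c)_k the power
   (z_l / z_1)^k may be replaced by its binomial remainder of order j - 1, which
   is at most (N h)^{j-1}.

   Lower bound: for q = N / s the s x s blocks of V with rows r, r + q, ...,
   r + (s-1) q, for 0 <= r < q, have Vandermonde determinants of modulus at
   least (rho N h)^{s(s-1)/2}. Averaging over r gives a block whose columns in
   the eigenbasis are at most of order sigma_i / sqrt N, so the product of the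
   sigma_i is at least of order N^{s/2} (N h)^{s(s-1)/2}; dividing by the upper
   bounds of all sigma_i but one bounds the remaining one from below. *)
Require Import Defs.
From mathcomp Require Import all_boot all_order all_algebra.
From mathcomp Require Import complex.
From mathcomp Require Import boolp classical_sets reals trigo.
From mathcomp Require Import perm ring lra topology normedtype derive.

Set Implicit Arguments.
Unset Strict Implicit.
Unset Printing Implicit Defensive.

Import Order.TTheory GRing.Theory Num.Theory.
Import numFieldNormedType.Exports.
Local Open Scope ring_scope.
Local Open Scope complex_scope.
Local Open Scope sesquilinear_scope.

(** * Powers of a unimodular number near 1 *)

(** Pascal's rule expresses the remainder of order j + 1 at exponent k + 1 as the remainder of order
    j + 1 at k plus w - 1 times the remainder of order j at k. A double induction with d = |w - 1|
    then needs only (k d)^(j+1) + d (k d)^j = (k + 1) d (k d)^j <= ((k + 1) d)^(j+1). *)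
Lemma norm_binomial_remainder (C : numDomainType) (w : C) (j k : nat) :
  `|w| = 1 ->
  `|w ^+ k - \sum_(m < j) (w - 1) ^+ m *+ 'C(k, m)| <= (k%:R * `|w - 1|) ^+ j.
Proof.
move=> w1; elim: j k => [|j IHj] k.
  by rewrite big_ord0 subr0 normrX w1 expr1n expr0.
elim: k => [|k IHk].
  by rewrite big_ord_recl big1 ?addr0 ?subrr ?normr0 ?mul0r ?exprn_ge0// => m _.
have -> : w ^+ k.+1 - \sum_(m < j.+1) (w - 1) ^+ m *+ 'C(k.+1, m) =
    (w ^+ k - \sum_(m < j.+1) (w - 1) ^+ m *+ 'C(k, m)) +
    (w - 1) * (w ^+ k - \sum_(m < j) (w - 1) ^+ m *+ 'C(k, m)).
  rewrite !(big_ord_recl j) !bin0 /=.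
  under eq_bigr => i _ do rewrite binS mulrnDr.
  rewrite big_split/= mulrBr.
  have <- : \sum_(i < j) (w - 1) ^+ bump 0 i *+ 'C(k, i) =
      (w - 1) * (\sum_(m < j) (w - 1) ^+ m *+ 'C(k, m)).
    by rewrite mulr_sumr; apply: eq_bigr => i _; rewrite exprS mulrnAr.
  rewrite exprS; ring.
apply: (le_trans (ler_normD _ _)); rewrite normrM.
apply: (@le_trans _ _ ((k%:R * `|w - 1|) ^+ j.+1
                        + `|w - 1| * (k%:R * `|w - 1|) ^+ j)).
  by rewrite lerD// ler_wpM2l.
rewrite exprS -mulrDl -[X in _ + X]mul1r -mulrDl -natr1 [leRHS]exprS.
rewrite ler_wpM2l ?mulr_ge0 ?addr_ge0//.
by rewrite lerXn2r ?nnegrE ?mulr_ge0 ?addr_ge0// ler_wpM2r// lerDl.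
Qed.

(** Factor w^q - 1 as (w - 1) times a geometric sum. Each of its q terms is within q |w - 1| <= 1/2
    of 1, so the sum has modulus at least q / 2. *)
Lemma norm_expr_sub1_ge (C : numFieldType) (w : C) (q : nat) :
  `|w| = 1 -> q%:R * `|w - 1| <= 2^-1 -> q%:R * `|w - 1| / 2 <= `|w ^+ q - 1|.
Proof.
move=> w1 wq.
have dev k : `|w ^+ k - 1| <= k%:R * `|w - 1|.
  by have := norm_binomial_remainder 1 k w1; rewrite big_ord1 bin0 expr0 expr1.
rewrite subrX1 normrM mulrAC mulrC ler_wpM2l//.
have -> : \sum_(i < q) w ^+ i = q%:R + \sum_(i < q) (w ^+ i - 1).
  by rewrite sumrB sumr_const card_ord addrC subrK.
apply: le_trans (lerB_normD _ _); rewrite normr_nat lerBrDr -lerBrDl.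
have -> : q%:R - q%:R / 2 = q%:R * 2^-1 :> C by field.
apply: (le_trans (ler_norm_sum _ _ _)).
apply: (@le_trans _ _ (\sum_(i < q) (2^-1 : C))); last first.
  by rewrite sumr_const card_ord mulr_natl.
apply: ler_sum => i _; apply: (le_trans (dev i)); apply: le_trans wq.
by rewrite ler_wpM2r// ler_nat ltnW.
Qed.

(** * Unitary matrices, determinants and diagonal Gram matrices *)

Lemma norm_det_unitarymx (C : numClosedFieldType) (n : nat) (U : 'M[C]_n) :
  U \is unitarymx -> `|\det U| = 1.
Proof.
move=> /unitarymxP /(congr1 determinant); rewrite det_mulmx det1 det_map_mx det_tr.
by rewrite -normCK => /eqP; rewrite pexpr_eq1// => /eqP.
Qed.

Lemma norm_unitarymx_entry (C : numClosedFieldType) (n : nat) (U : 'M[C]_n) i j :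
  U \is unitarymx -> `|U i j| <= 1.
Proof.
move=> /unitarymxP /matrixP /(_ i i); rewrite !mxE eqxx (bigD1 j)//= !mxE -normCK.
rewrite mulr1n => UU; rewrite -(@ler_pXn2r _ 2) ?nnegrE// expr1n -{}UU lerDl.
by apply: sumr_ge0 => k _; rewrite !mxE -normCK exprn_ge0.
Qed.

(** A crude substitute for Hadamard's inequality: each of the n! terms of the Leibniz formula takes
    one entry from every column i, of modulus at most the square root of [c i]. *)
Lemma det_normsq_le (C : numClosedFieldType) (n : nat) (B : 'M[C]_n)
    (c : 'I_n -> C) :
  (forall l i, `|B l i| ^+ 2 <= c i) -> `|\det B| ^+ 2 <= n`!%:R ^+ 2 * \prod_i c i.
Proof.
move=> Bc; case: n B c Bc => [|n] B c Bc.
  by rewrite det_mx00 big_ord0 normr1 mulr1 -natrX.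
have c_ge0 i : 0 <= c i by apply: le_trans (Bc ord0 i); rewrite exprn_ge0.
have detB : `|\det B| <= n.+1`!%:R * \prod_i sqrtC (c i).
  rewrite /determinant; apply: (le_trans (ler_norm_sum _ _ _)).
  apply: (@le_trans _ _ (\sum_(p : 'S_n.+1) \prod_i sqrtC (c i))); last first.
    rewrite sumr_const mulr_natl.
    by have /eq_card -> : 'S_n.+1 =i 'S_(n.+1) by []; rewrite card_Sn.
  apply: ler_sum => p _; rewrite normrM normrX normrN1 expr1n mul1r normr_prod.
  rewrite (reindex_inj (@perm_inj _ p^-1)); apply: ler_prod => i _.
  rewrite permKV normr_ge0/= -(@ler_pXn2r _ 2) ?nnegrE ?sqrtC_ge0//.
  by rewrite sqrtCK.
apply: (@le_trans _ _ ((n.+1`!%:R * \prod_i sqrtC (c i)) ^+ 2)).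
  by rewrite ler_pXn2r ?nnegrE// mulr_ge0// prodr_ge0// => i _; rewrite sqrtC_ge0.
by rewrite exprMn -prodrXl; under eq_bigr do rewrite sqrtCK.
Qed.

(** Pythagoras: the columns of [G] are orthogonal with squared norms [lam i]. *)
Lemma sum_normsq_gram_diag (C : numClosedFieldType) (m n : nat)
    (G : 'M[C]_(m, n)) (lam : 'I_n -> C) (b : 'cV[C]_n) :
  G^t* *m G = diag_mx (\row_i lam i) ->
  \sum_k `|(G *m b) k 0| ^+ 2 = \sum_i lam i * `|b i 0| ^+ 2.
Proof.
move=> GG; have : ((G *m b)^t* *m (G *m b)) 0 0 = (b^t* *m (G^t* *m G) *m b) 0 0.
  by rewrite trmx_mul map_mxM !mulmxA.
rewrite GG mul_mx_diag !mxE => E.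
rewrite (eq_bigr (fun k => (G *m b)^t* 0 k * (G *m b) k 0)); last first.
  by move=> k _; rewrite normCK mulrC; congr (_ * _); rewrite [RHS]mxE [in RHS]mxE.
rewrite {}E; apply: eq_bigr => i _.
by rewrite !mxE normCK; ring.
Qed.

Lemma sum_normsq_col_gram_diag (C : numClosedFieldType) (m n : nat)
    (G : 'M[C]_(m, n)) (lam : 'I_n -> C) (i : 'I_n) :
  G^t* *m G = diag_mx (\row_i lam i) -> \sum_k `|G k i| ^+ 2 = lam i.
Proof.
move=> /matrixP /(_ i i); rewrite !mxE eqxx mulr1n => <-.
by apply: eq_bigr => k _; rewrite !mxE normCK mulrC.
Qed.

(** * Eigenvalue bounds for the Gram matrix of a unimodular Vandermonde matrix *)

Section VandermondeGram.
Variables (C : numClosedFieldType) (N s : nat) (z : 'I_s -> C) (U : 'M[C]_s).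
Variable lam : 'I_s -> C.
Hypothesis z1 : forall l, `|z l| = 1.
Hypothesis U_unitary : U \is unitarymx.

Let V := \matrix_(k < N.+1, l < s) z l ^+ k.
Hypothesis gramVU : (V *m U)^t* *m (V *m U) = diag_mx (\row_i lam i).

(** A min-max argument: on the span of the first j + 1 eigenvectors the quadratic form dominates
    [lam j], so one trial vector with a small image suffices. Since j counts from 0, there are j + 1
    coordinates for j vanishing conditions. *)
Lemma vandermonde_gram_eigen_le (l0 : 'I_s) (delta : C) (j : 'I_s) :
  (forall l, `|z l - z l0| <= delta) ->
  (forall i i' : 'I_s, (i <= i')%N -> lam i' <= lam i) ->
  lam j <= N.+1%:R * s%:R ^+ 4 * (N%:R * delta) ^+ (2 * j).
Proof.
move=> zdelta lam_mono.
have delta_ge0 : 0 <= delta by apply: le_trans (zdelta l0).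
have lam_ge0 i : 0 <= lam i.
  rewrite -(sum_normsq_col_gram_diag i gramVU) sumr_ge0// => k _.
  by rewrite exprn_ge0.
pose w l := z l / z l0.
have z0 l : z l != 0 by rewrite -normr_gt0 z1.
have w1 l : `|w l| = 1 by rewrite normf_div !z1 divr1.
have wdelta l : `|w l - 1| <= delta.
  rewrite -[1](divff (z0 l0)) -mulrBl normf_div z1 divr1; exact: zdelta.
(* The kernel vector [b] of this singular matrix is supported on the first
   [j.+1] eigenvectors, and [U b] annihilates the polynomials of degree [< j]
   in [w - 1]. *)
pose D := \matrix_(i < s, m < s)
  if (m < j)%N then \sum_l U l i * (w l - 1) ^+ m else
  if m == j then 0 else (i == m)%:R : C.
have /eqP/det0P[b b0 bD] : \det D = 0.
  rewrite (expand_det_col _ j) big1// => i _.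
  by rewrite mxE ltnn eqxx mul0r.
have b_supp (i : 'I_s) : (j < i)%N -> b 0 i = 0.
  move=> ji; move/matrixP: bD => /(_ 0 i); rewrite !mxE (bigD1 i)//= big1.
    by rewrite mxE ltnNge ltnW//= -val_eqE gtn_eqF//= eqxx mulr1 addr0.
  by move=> i' /negPf i'i; rewrite mxE ltnNge ltnW//= -val_eqE gtn_eqF//= i'i mulr0.
pose c := U *m b^T.
have c_mom (m : nat) : (m < j)%N -> \sum_l c l 0 * (w l - 1) ^+ m = 0.
  move=> mj; have ms : (m < s)%N by apply: ltn_trans mj _.
  move/matrixP: bD => /(_ 0 (Ordinal ms)); rewrite !mxE => bD; rewrite -[RHS]bD.
  under eq_bigr do rewrite mxE mulr_suml.
  rewrite exchange_big; apply: eq_bigr => i _; rewrite !mxE mj mulr_sumr.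
  by apply: eq_bigr => l _; rewrite mulrAC mulrC.
(* The vector is normalized by its largest coordinate, which avoids the Euclidean norm. This costs a
   factor s for the entries of [U b] and another for the sum over the nodes, whence s^4 after
   squaring. *)
have [i0 bi0] : exists i0, forall i, `|b 0 i| <= `|b 0 i0|.
  have [i0 _ Hi0] := @real_arg_maxP _ _ j xpredT (fun i => `|b 0 i|) isT
     (fun i _ => normr_real _).
  by exists i0 => i; apply: Hi0.
have beta_gt0 : 0 < `|b 0 i0|.
  rewrite lt_neqAle normr_ge0 andbT eq_sym; apply: contraNneq b0 => B0.
  apply/eqP/rowP => i; rewrite mxE; apply/eqP.
  by rewrite -normr_le0 -B0.
have i0j : (i0 <= j)%N.
  by rewrite leqNgt; apply/negP => /b_supp E; rewrite E normr0 ltxx in beta_gt0.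
have c_le l : `|c l 0| <= s%:R * `|b 0 i0|.
  rewrite mxE; apply: (le_trans (ler_norm_sum _ _ _)).
  rewrite -[s in s%:R]card_ord mulr_natl -sumr_const; apply: ler_sum => i _.
  rewrite normrM mxE -[leRHS]mul1r ler_pM//; exact: norm_unitarymx_entry.
have Vc_le k : `|(V *m c) k 0| <= s%:R ^+ 2 * (N%:R * delta) ^+ j * `|b 0 i0|.
  have -> : (V *m c) k 0 = z l0 ^+ k * \sum_l c l 0 *
      (w l ^+ k - \sum_(m < j) (w l - 1) ^+ m *+ 'C(k, m)).
    under eq_bigr do rewrite mulrBr.
    rewrite sumrB [X in _ - X](_ : _ = 0).
      rewrite subr0 mulr_sumr mxE; apply: eq_bigr => l _.
      by rewrite mxE mulrCA -exprMn /w mulrCA divff// mulr1 mulrC.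
    under eq_bigr do rewrite mulr_sumr.
    rewrite exchange_big big1// => m _.
    under eq_bigr do rewrite mulrnAr.
    by rewrite sumrMnl c_mom// mul0rn.
  rewrite normrM normrX z1 expr1n mul1r; apply: (le_trans (ler_norm_sum _ _ _)).
  apply: (@le_trans _ _ (\sum_(l < s) s%:R * `|b 0 i0| * (N%:R * delta) ^+ j)).
    apply: ler_sum => l _; rewrite normrM ler_pM//.
    apply: (le_trans (norm_binomial_remainder _ _ (w1 l))).
    by rewrite lerXn2r ?nnegrE ?mulr_ge0// ler_pM// ler_nat -ltnS.
  rewrite sumr_const card_ord -mulr_natl le_eqVlt.
  by apply/orP; left; apply/eqP; ring.
rewrite -(ler_pM2r (exprn_gt0 2 beta_gt0)).
apply: (@le_trans _ _ (\sum_i lam i * `|b^T i 0| ^+ 2)).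
  rewrite (bigD1 i0)//= mxE; apply: ler_wpDr.
    by apply: sumr_ge0 => i _; rewrite mulr_ge0// exprn_ge0.
  by rewrite ler_wpM2r ?exprn_ge0// lam_mono.
rewrite -(sum_normsq_gram_diag _ gramVU).
apply: (@le_trans _ _ (\sum_(k < N.+1)
   (s%:R ^+ 2 * (N%:R * delta) ^+ j * `|b 0 i0|) ^+ 2)).
  apply: ler_sum => k _; rewrite lerXn2r ?nnegrE ?mulr_ge0 ?exprn_ge0 ?mulr_ge0//.
  by rewrite -mulmxA.
rewrite sumr_const card_ord -mulr_natl mulnC (exprM _ j 2).
by rewrite le_eqVlt; apply/orP; left; apply/eqP; ring.
Qed.

(** All blocks [A r] share the determinant modulus of the Vandermonde matrix of the nodes z_l^q. For
    a well chosen r, the entries of every column i of [A r *m U] are bounded simultaneously in terms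
    of [lam i], and [det_normsq_le] compares the two. *)
Lemma vandermonde_gram_eigen_prod_ge (q : nat) (kappa : C) :
  (0 < q)%N -> (q * s <= N.+1)%N -> 0 <= kappa ->
  (forall l l', l != l' -> kappa <= `|z l ^+ q - z l' ^+ q|) ->
  \prod_(i < s) kappa ^+ (2 * i) <=
    s`!%:R ^+ 2 * (s%:R ^+ 2 / q%:R) ^+ s * \prod_i lam i.
Proof.
move=> q_gt0 qsN kappa_ge0 zkappa.
have rowP (r : 'I_q) (l' : 'I_s) : (r + q * l' < N.+1)%N.
  apply: leq_trans qsN; apply: (@leq_trans (q + q * l')); first by rewrite ltn_add2r.
  by rewrite -mulnS leq_mul2l ltn_ord orbT.
pose row r l' := Ordinal (rowP r l').
pose A (r : 'I_q) := \matrix_(l' < s, l < s) z l ^+ (r + q * l').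
have AU r l' i : (A r *m U) l' i = (V *m U) (row r l') i.
  by rewrite !mxE; apply: eq_bigr => l _; rewrite !mxE.
have lamE i := sum_normsq_col_gram_diag i gramVU.
have lam_ge0 i : 0 <= lam i.
  by rewrite -lamE sumr_ge0// => k _; rewrite exprn_ge0.
have row_le l' i : \sum_r `|(A r *m U) l' i| ^+ 2 <= lam i.
  have row_inj : injective (row^~ l').
    by move=> r r' /(congr1 val)/eqP; rewrite /= eqn_add2r => /eqP/val_inj.
  rewrite -lamE; under eq_bigr do rewrite AU.
  rewrite -(big_imset (fun k => `|(V *m U) k i| ^+ 2) (in2W row_inj)) /=.
  rewrite [leRHS](bigID (mem (row^~ l' @: 'I_q)))/= lerDl.
  by apply: sumr_ge0 => k _; rewrite exprn_ge0.
pose Q r i := \sum_l' `|(A r *m U) l' i| ^+ 2.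
have Q_ge0 r i : 0 <= Q r i by apply: sumr_ge0 => l' _; rewrite exprn_ge0.
have sumQ i : \sum_r Q r i <= s%:R * lam i.
  rewrite exchange_big/= mulr_natl -[s in leRHS]card_ord -sumr_const.
  by apply: ler_sum => l' _; apply: row_le.
have Q_le r i : Q r i <= s%:R * lam i.
  apply: le_trans (sumQ i); rewrite (bigD1 r)//= lerDl.
  by apply: sumr_ge0.
have q0 : 0 < q%:R :> C by rewrite ltr0n.
(* A vanishing [lam i] is harmless: then [Q r i] is zero too, and the quotient is 0 by
   convention. *)
have QlamK r i : Q r i = Q r i / lam i * lam i.
  have [l0|l0] := eqVneq (lam i) 0; last by rewrite divfK.
  rewrite l0 mulr0; apply/eqP; rewrite eq_le Q_ge0 andbT.
  by have := Q_le r i; rewrite l0 mulr0.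
(* Averaging over the q blocks: for each i the ratios [Q r i / lam i] sum over r to at most s, so
   the total over r and i is at most s^2. *)
have [r Qr] : exists r, \sum_i Q r i / lam i <= s%:R ^+ 2 / q%:R.
  pose S r := \sum_i Q r i / lam i.
  have S_ge0 r : 0 <= S r by apply: sumr_ge0 => i _; rewrite divr_ge0.
  have Sreal r : S r \is Num.real by apply: ger0_real.
  have Treal : s%:R ^+ 2 / q%:R \is @Num.real C.
    by apply: ger0_real; rewrite divr_ge0 ?exprn_ge0.
  have [/existsP[r Hr]|/existsPn nex] := boolP [exists r, S r <= s%:R ^+ 2 / q%:R].
    by exists r.
  have : s%:R ^+ 2 < \sum_r S r.
    rewrite -[ltLHS](divfK (lt0r_neq0 q0)) mulr_natr -[q in _ *+ q]card_ord -sumr_const.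
    apply: ltr_sum => [|r _]; last by rewrite real_ltNge.
    by apply/hasP; exists (Ordinal q_gt0); rewrite ?mem_index_enum.
  suff le_sS : \sum_r S r <= s%:R ^+ 2.
    by move=> /lt_le_trans /(_ le_sS); rewrite ltxx.
  rewrite exchange_big/= expr2 mulr_natl -[s in _ *+ s]card_ord -sumr_const.
  apply: ler_sum => i _; rewrite -mulr_suml.
  have [l0|l0] := eqVneq (lam i) 0; first by rewrite l0 invr0 mulr0.
  by rewrite ler_pdivrMr// lt_neqAle eq_sym l0 lam_ge0.
have AU_le l' i : `|(A r *m U) l' i| ^+ 2 <= s%:R ^+ 2 / q%:R * lam i.
  apply: (@le_trans _ _ (Q r i)).
    rewrite /Q (bigD1 l')//= lerDl.
    by apply: sumr_ge0 => l'' _; rewrite exprn_ge0.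
  rewrite QlamK ler_wpM2r//; apply: le_trans Qr; rewrite (bigD1 i)//= lerDl.
  by apply: sumr_ge0 => i' _; rewrite divr_ge0.
have := det_normsq_le AU_le.
rewrite det_mulmx normrM (norm_det_unitarymx U_unitary) mulr1.
rewrite big_split/= prodr_const card_ord mulrA; apply: le_trans.
have -> : `|\det (A r)| = `|\det (Vandermonde s (\row_l z l ^+ q))|.
  have -> : A r = Vandermonde s (\row_l z l ^+ q) *m diag_mx (\row_l z l ^+ r).
    by apply/matrixP => l' l; rewrite mul_mx_diag !mxE exprD -exprM mulrC.
  rewrite det_mulmx det_diag normrM (normr_prod _ _ (fun l => _ 0 l)).
  by rewrite [X in _ * X]big1 ?mulr1// => l _; rewrite mxE normrX z1 expr1n.
rewrite det_Vandermonde; under eq_bigr do rewrite mulnC exprM.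
rewrite prodrXl lerXn2r ?nnegrE ?prodr_ge0// => [i _|]; first by rewrite exprn_ge0.
(* Node i is paired with the s - 1 - i nodes after it, so the exponents of kappa are matched after
   reversing the order. *)
rewrite normr_prod (reindex_inj rev_ord_inj)/=; apply: ler_prod => i _.
rewrite exprn_ge0//= normr_prod.
apply: (@le_trans _ _ (\prod_(l < s | (i < l)%N) kappa)).
  rewrite -(big_mkord (fun l => (i < l)%N) (fun=> kappa)).
  by rewrite -(big_nat_widenl i.+1 0 s xpredT)// prodr_const_nat.
apply: ler_prod => l il; rewrite kappa_ge0/= !mxE zkappa//.
by rewrite -val_eqE gtn_eqF.
Qed.

End VandermondeGram.

(** Bounding all factors but [lam j] from above cancels every power of eta except eta^(2j); the n^s
    from the product bound against n^(s-1) from these factors leaves a single n. *)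
Lemma prod_le_factor_ge (R : realFieldType) (s : nat) (lam : 'I_s -> R)
    (a b rho eta n : R) (j : 'I_s) :
  0 < a -> 0 < b -> 0 < rho -> 0 < eta -> 0 < n ->
  (forall i, 0 <= lam i) ->
  (forall i, lam i <= a * n * eta ^+ (2 * i)) ->
  \prod_(i < s) (rho * eta) ^+ (2 * i) <= b * n^-1 ^+ s * \prod_i lam i ->
  (\prod_(i < s) rho ^+ (2 * i)) / (b * a ^+ s.-1) * n * eta ^+ (2 * j) <= lam j.
Proof.
move=> a0 b0 rho0 eta0 n0 lam0 lam_le prod_le.
have s0 : (0 < s)%N by apply: leq_ltn_trans (ltn_ord j).
pose E := \prod_(i < s | i != j) eta ^+ (2 * i).
have E0 : 0 < E by apply: prodr_gt0 => i _; rewrite exprn_gt0.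
have prod_others : \prod_(i < s | i != j) lam i <= (a * n) ^+ s.-1 * E.
  rewrite -[s.-1](_ : #|[pred i : 'I_s | i != j]| = _); last first.
    by rewrite cardC1 card_ord.
  rewrite -prodr_const -big_split/=; apply: ler_prod => i _.
  by rewrite lam0 lam_le.
have {prod_le} : (\prod_(i < s) rho ^+ (2 * i)) *
    (eta ^+ (2 * j) * \prod_(i < s | i != j) eta ^+ (2 * i)) <=
    b * n^-1 ^+ s * (lam j * ((a * n) ^+ s.-1 * E)).
  have <- : \prod_(i < s) eta ^+ (2 * i) =
    eta ^+ (2 * j) * \prod_(i < s | i != j) eta ^+ (2 * i) by rewrite (bigD1 j).
  rewrite -big_split/=; under eq_bigr do rewrite -exprMn.
  apply: (le_trans prod_le); rewrite ler_wpM2l//.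
    by rewrite mulr_ge0 ?exprn_ge0 ?invr_ge0// ltW.
  by rewrite (bigD1 j)//= ler_wpM2l.
have -> : b * n^-1 ^+ s * (lam j * ((a * n) ^+ s.-1 * E)) =
    (lam j * (b * a ^+ s.-1) / n) * E.
  rewrite -{1}(prednK s0) exprS exprMn exprVn; field.
  by rewrite expf_neq0 gt_eqF.
rewrite -/E mulrA ler_pM2r// ler_pdivlMr// => H.
rewrite -[leLHS]mulrA mulrAC ler_pdivrMr ?mulr_gt0 ?exprn_gt0//.
by rewrite [n * _]mulrC mulrA.
Qed.

(** * Singular values and a sorted eigenbasis *)

Section SingularValues.
Variable R : realType.

Lemma size_singular_values m n (A : 'M[R[i]]_(m, n)) : size (singular_values A) = n.
Proof. by rewrite size_sort size_map size_enum_ord. Qed.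

Lemma sigma_ge0 m n (A : 'M[R[i]]_(m, n)) j : 0 <= sigma j A.
Proof.
rewrite /sigma; have [jn|jn] := ltnP j.-1 (size (singular_values A)).
  have /allP /(_ _ (mem_nth 0 jn)) // : all (fun x => 0 <= x) (singular_values A).
  by rewrite all_sort; apply/allP => _ /mapP[i _ ->]; rewrite sqrtr_ge0.
by rewrite nth_default.
Qed.

Lemma sigma_anti m n (A : 'M[R[i]]_(m, n)) i j :
  (i <= j)%N -> (j < n)%N -> sigma j.+1 A <= sigma i.+1 A.
Proof.
move=> ij jn; apply: (@sorted_leq_nth _ >=%R) => //.
- by move=> x y z xy yz; apply: le_trans xy.
- by move=> x; apply: lexx.
- by rewrite /singular_values sort_sorted// => x y; apply: le_total.
- by rewrite inE size_singular_values (leq_ltn_trans ij).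
- by rewrite inE size_singular_values.
Qed.

(** The spectral theorem lists the eigenvalues in no prescribed order. Sorting amounts to a
    permutation [p], and permuting the eigenvectors by [p] keeps the basis unitary. *)
Lemma singular_value_diagonalization m n (A : 'M[R[i]]_(m, n)) :
  exists2 U : 'M[R[i]]_n, U \is unitarymx &
    (A *m U)^t* *m (A *m U) = diag_mx (\row_i (sigma i.+1 A ^+ 2)%:C).
Proof.
set M := A^t* *m A; set P := spectralmx M; set sp := spectral_diag M.
have P_unitary : P \is unitarymx by apply: spectral_unitarymx.
have /orthomx_spectralP : M \is normalmx.
  by apply/normalmxP; rewrite /M trmx_mul map_mxM trmxCK.
rewrite -/P -/sp (invmx_unitary P_unitary) => ME.
have gramP : (A *m P^t*)^t* *m (A *m P^t*) = diag_mx (\row_i sp 0 i).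
  rewrite trmx_mul map_mxM trmxCK -mulmxA [_ *m (A *m _)]mulmxA -/M ME.
  rewrite !mulmxA (unitarymxP P_unitary) mul1mx -mulmxA (unitarymxP P_unitary) mulmx1.
  by congr diag_mx; apply/rowP => i; rewrite mxE.
(* An eigenvalue is the squared norm of a column of [A *m P^t*], so taking its real part and then
   the square root loses nothing. *)
have sp_ge0 i : 0 <= sp 0 i.
  have <- := sum_normsq_col_gram_diag (lam := fun i => sp 0 i) i gramP.
  by apply: sumr_ge0 => k _; rewrite exprn_ge0.
have spE i : sp 0 i = (complex.Re (sp 0 i))%:C.
  by rewrite RRe_real// ger0_real.
have Resp_ge0 i : 0 <= complex.Re (sp 0 i) by rewrite -lecR -spE.
have size_sv := size_singular_values A.
pose sv := [tuple Num.sqrt (complex.Re (sp 0 i)) | i < n].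
have /tuple_permP[p svE] : perm_eq (singular_values A) sv by rewrite perm_sort.
have sigmaE (i : 'I_n) : sigma i.+1 A = Num.sqrt (complex.Re (sp 0 (p i))).
  by rewrite /sigma svE -tnth_nth !tnth_mktuple.
exists (\matrix_(k, l) P^t* k (p l)).
  rewrite -trmxC_unitary; apply/unitarymxP; rewrite trmxCK.
  have /unitarymxP : P \is unitarymx by [].
  move=> /matrixP PP; apply/matrixP => i j; rewrite mxE.
  have := PP (p i) (p j); rewrite !mxE (inj_eq perm_inj) => <-.
  by apply: eq_bigr => k _; rewrite !mxE conjCK.
apply/matrixP => i j; have /matrixP/(_ (p i) (p j)) := gramP.
have AUE k l : (A *m (\matrix_(k, l) P^t* k (p l))) k l = (A *m P^t*) k (p l).
  by rewrite !mxE; apply: eq_bigr => ? _; rewrite !mxE.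
rewrite [in LHS]mxE => E; rewrite [LHS]mxE.
transitivity (\sum_k ((A *m P^t*)^t*) (p i) k * (A *m P^t*) k (p j)).
  apply: eq_bigr => k _; rewrite AUE; congr (_ * _).
  by rewrite [LHS]mxE [in LHS]mxE AUE [RHS]mxE [in RHS]mxE.
rewrite {}E !mxE (inj_eq perm_inj); congr (_ *+ _).
by rewrite sigmaE sqr_sqrtr// -spE.
Qed.

End SingularValues.

(** * Angles and chord lengths on the unit circle *)

Section Expi.
Variable R : realType.
Implicit Types x y t theta : R.

Lemma expiD x y : expi (x + y) = expi x * expi y.
Proof. by rewrite /expi cosD sinD; simpc; rewrite [sin x * _ + _]addrC. Qed.

Lemma expi0 : expi (0 : R) = 1.
Proof. by rewrite /expi cos0 sin0. Qed.

Lemma expi_natl k x : expi (k%:R * x) = expi x ^+ k.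
Proof.
elim: k => [|k IHk]; first by rewrite mul0r expi0.
by rewrite -natr1 mulrDl mul1r expiD IHk exprSr.
Qed.

Lemma norm_expi x : `|expi x| = 1.
Proof. by rewrite normc_def /= cos2Dsin2 sqrtr1. Qed.

Lemma expiD2pi x : expi (x + pi *+ 2) = expi x.
Proof. by rewrite /expi cosD2pi sinD2pi. Qed.

(** The range of t contains all differences of two principal angles. At most one shift by 2 pi
    brings t into (-pi, pi], so the set defining [Arg] is nonempty and [xget] returns a member of
    it. *)
Lemma expi_Arg t : - (pi *+ 2) < t < pi *+ 2 -> expi (Arg (expi t)) = expi t.
Proof.
move=> /andP[t_gt t_lt]; pose P u := (- pi < u <= pi) /\ expi t = `|expi t| * expi u.
have : exists u, P u.
  rewrite /P norm_expi; have pi0 := pi_gt0 R.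
  have [tpi|tpi] := lerP t (- pi); last have [tpi'|tpi'] := lerP t pi.
  - exists (t + pi *+ 2); rewrite mul1r expiD2pi; split=> //; lra.
  - by exists t; rewrite mul1r; split=> //; lra.
  - exists (t - pi *+ 2); rewrite mul1r -[in LHS](subrK (pi *+ 2) t) expiD2pi.
    by split=> //; lra.
move=> /(xgetPex 0)[_]; rewrite -[xget 0 P]/(Arg (expi t)).
by move: (Arg _) => u; rewrite norm_expi mul1r.
Qed.

Lemma sin_le_id theta : 0 <= theta -> sin theta <= theta.
Proof.
move=> theta0.
have [//|c _] := @MVT_segment _ _ cos 0 theta theta0 (fun x _ => is_derive_sin x).
  by apply: continuous_subspaceT => x; apply: continuous_sin.
by rewrite sin0 !subr0 => ->; rewrite -[leRHS]mul1r ler_wpM2r// cos_le1.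
Qed.

(** By the mean value theorem sin theta = theta cos c with 0 <= c <= 1, and cosine decreases
    there. *)
Lemma cos1_mul_le_sin theta : 0 <= theta <= 1 -> cos 1 * theta <= sin theta.
Proof.
move=> /andP[theta0 theta1].
have [//|c] := @MVT_segment _ _ cos 0 theta theta0 (fun x _ => is_derive_sin x).
  by apply: continuous_subspaceT => x; apply: continuous_sin.
rewrite in_itv/= => /andP[c0 ct]; rewrite sin0 !subr0 => ->.
have pi2 := pi_ge2 R.
rewrite ler_wpM2r// leNgt ltr_cos ?in_itv/= -?leNgt.
- exact: le_trans theta1.
- by lra.
- by apply/andP; split=> //; apply: (le_trans ct); lra.
Qed.

Lemma norm_expi_sub1 theta : `|expi theta - 1| = (2 * `|sin (theta / 2)|)%:C.
Proof.
rewrite normc_def; congr _%:C; rewrite /= subr0.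
set d := theta / 2; have -> : theta = d *+ 2 by rewrite /d; lra.
rewrite cos_mulr2n sin_mulr2n cos2sin2 exprMn_n exprMn cos2sin2.
rewrite -[RHS]ger0_norm ?mulr_ge0// -sqrtr_sqr exprMn real_normK ?num_real//.
congr Num.sqrt; ring.
Qed.

Lemma norm_expi_sub1_le theta : `|expi theta - 1| <= `|theta|%:C.
Proof.
rewrite norm_expi_sub1 lecR.
wlog theta0 : theta / 0 <= theta.
  move=> wlg; have [/wlg//|/ltW theta0] := leP 0 theta.
  by have := wlg (- theta); rewrite mulNr sinN !normrN oppr_ge0; apply.
rewrite [leRHS]ger0_norm//.
(* Beyond 2 the chord, of length at most 2, is trivially shorter than the angle; up to 2 the
   half-angle lies in [0, pi], where sine is nonnegative. *)
have [th|th] := leP theta 2; last first.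
  by apply: le_trans (ltW th); have := sin_max (theta / 2); lra.
rewrite ger0_norm; first by have := @sin_le_id (theta / 2); lra.
by rewrite sin_ge0_pi//; have := pi_ge2 R; lra.
Qed.

Lemma norm_expi_sub1_ge theta :
  `|theta| <= 1 -> (cos 1 * `|theta|)%:C <= `|expi theta - 1|.
Proof.
rewrite norm_expi_sub1 lecR.
wlog theta0 : theta / 0 <= theta.
  move=> wlg; have [/wlg//|/ltW theta0] := leP 0 theta.
  by have := wlg (- theta); rewrite mulNr sinN !normrN oppr_ge0; apply.
rewrite ger0_norm// => theta1; have := @cos1_mul_le_sin (theta / 2).
by have := ler_norm (sin (theta / 2)); lra.
Qed.

Lemma norm_expiB x y : `|expi x - expi y| = `|expi (x - y) - 1|.
Proof.
have -> : expi x - expi y = (expi (x - y) - 1) * expi y.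
  by rewrite mulrBl mul1r -expiD subrK.
by rewrite normrM norm_expi mulr1.
Qed.

End Expi.

(** * Node distances and singular value bounds for a cluster *)

Section Cluster.
Variables (R : realType) (s : nat) (h tau : R) (x : 'I_s -> R).
Hypothesis x_cluster : is_cluster h tau x.

(** Passes from the difference of two nodes, possibly near 2 pi in modulus, to its wrapped
    representative, which the cluster condition controls. *)
Lemma cluster_angle l l' : l != l' ->
  exists2 theta, tau * h <= `|theta| <= h & expi (x l - x l') = expi theta.
Proof.
have [x_inj x_bound x_dist] := x_cluster => ll'.
exists (Arg (expi (x l - x l'))); first by apply: x_dist; rewrite (inj_eq x_inj).
rewrite expi_Arg//.
have := x_bound l; have := x_bound l'; lra.
Qed.

Lemma cluster_node_dist_le l l' : 0 <= h -> `|expi (x l) - expi (x l')| <= h%:C.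
Proof.
move=> h0; have [->|ll'] := eqVneq l l'; first by rewrite subrr normr0 lecR.
have [theta /andP[_ thetah] E] := cluster_angle ll'.
by rewrite norm_expiB E (le_trans (norm_expi_sub1_le _))// lecR.
Qed.

(** Two nodes are at chord distance at least cos 1 times tau h because h <= 1; as q h <= 1/2, the
    q-th power stretches this distance by at least q / 2. *)
Lemma cluster_node_expr_dist_ge (q : nat) l l' : q%:R * h <= 2^-1 -> h <= 1 ->
  l != l' ->
  (q%:R * (cos 1 * (tau * h)) / 2)%:C <= `|expi (x l) ^+ q - expi (x l') ^+ q|.
Proof.
move=> qh h1 ll'; have [theta /andP[tautheta thetah] E] := cluster_angle ll'.
have -> : `|expi (x l) ^+ q - expi (x l') ^+ q| = `|expi theta ^+ q - 1|.
  by rewrite -!expi_natl norm_expiB -mulrBr !expi_natl E.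
apply: le_trans (norm_expr_sub1_ge (norm_expi theta) _); last first.
  have -> : 2^-1 = (2^-1)%:C :> R[i] by rewrite fmorphV rmorph_nat.
  apply: (@le_trans _ _ (q%:R * h)%:C); last by rewrite lecR.
  rewrite rmorphM rmorph_nat ler_wpM2l//.
  by apply: (le_trans (norm_expi_sub1_le _)); rewrite lecR.
rewrite !rmorphM fmorphV !rmorph_nat/= ler_wpM2r ?invr_ge0// ler_wpM2l//.
apply: le_trans (norm_expi_sub1_ge (le_trans thetah h1)).
by rewrite -!rmorphM lecR ler_wpM2l// ltW// cos1_gt0.
Qed.

Hypothesis h_gt0 : 0 < h.
Hypothesis s_gt0 : (0 < s)%N.
Variable N : nat.
Hypothesis sN : (s <= N)%N.

Let lam (i : 'I_s) := sigma i.+1 (vandermonde N x) ^+ 2.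

Lemma vandermonde_cluster_gram :
  exists2 U : 'M[R[i]]_s, U \is unitarymx &
    let V := \matrix_(k < N.+1, l < s) expi (x l) ^+ k in
    (V *m U)^t* *m (V *m U) = diag_mx (\row_i (lam i)%:C).
Proof.
have [U U_unitary UE] := singular_value_diagonalization (vandermonde N x).
exists U => //=; rewrite -UE.
rewrite (_ : \matrix_(k, l) _ = vandermonde N x)//.
by apply/matrixP => k l; rewrite !mxE expi_natl.
Qed.

Lemma cluster_sigma_sqr_le i :
  lam i <= N.+1%:R * s%:R ^+ 4 * (N%:R * h) ^+ (2 * i).
Proof.
have [U U_unitary UE] := vandermonde_cluster_gram.
rewrite -lecR.
have -> : (N.+1%:R * s%:R ^+ 4 * (N%:R * h) ^+ (2 * i))%:C =
    N.+1%:R * s%:R ^+ 4 * (N%:R * h%:C) ^+ (2 * i) :> R[i].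
  by rewrite !(rmorphXn, rmorphM, rmorph_nat).
apply: (vandermonde_gram_eigen_le (fun l => norm_expi (x l)) U_unitary UE
  (l0 := Ordinal s_gt0)) => [l|j j' jj'].
  by apply: cluster_node_dist_le; apply: ltW.
by rewrite lecR ler_pXn2r ?nnegrE ?sigma_ge0// sigma_anti.
Qed.

Lemma cluster_sigma_sqr_prod_ge :
  0 < tau -> N%:R * h <= 2^-1 ->
  \prod_(i < s) (cos 1 * tau / (4 * s%:R) * (N%:R * h)) ^+ (2 * i) <=
    s`!%:R ^+ 2 * (2 * s%:R ^+ 3) ^+ s * N%:R^-1 ^+ s * \prod_i lam i.
Proof.
move=> tau_gt0 Nh; have [U U_unitary UE] := vandermonde_cluster_gram.
have cos1 := @cos1_gt0 R.
(* Since s <= N, rounding down loses at most a factor 2, that is N <= 2 q s. This gives the 4 s in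
   [kappa] and turns s^2 / q into 2 s^3 / N. *)
pose q := (N %/ s)%N.
have N_gt0 : (0 < N)%N by apply: leq_trans sN.
have q_gt0 : (0 < q)%N by rewrite divn_gt0.
have qs : (q * s <= N)%N by apply: leq_divM.
have Nqs : (N <= 2 * q * s)%N.
  have := ltn_ceil N s_gt0; rewrite -/q mulSn -mulnA mul2n -addnn => /ltnW/leq_trans.
  by apply; rewrite leq_add2r leq_pmull.
have qN : (q <= N)%N by apply: leq_div.
have N0 : 0 < N%:R :> R by rewrite ltr0n.
have s0 : 0 < s%:R :> R by rewrite ltr0n.
have q0 : 0 < q%:R :> R by rewrite ltr0n.
have NqsR : N%:R <= 2 * q%:R * s%:R :> R by rewrite -!natrM ler_nat.
set kappa := cos 1 * tau / (4 * s%:R) * (N%:R * h).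
have kappa_ge0 : 0 <= kappa.
  by rewrite /kappa !(mulr_ge0, invr_ge0)// ltW.
have kappa_le l l' : l != l' ->
    kappa%:C <= `|expi (x l) ^+ q - expi (x l') ^+ q|.
  move=> ll'; apply: le_trans (cluster_node_expr_dist_ge _ _ ll').
  - rewrite lecR /kappa.
    have -> : q%:R * (cos 1 * (tau * h)) / 2 =
        cos 1 * tau / (4 * s%:R) * (2 * q%:R * s%:R * h).
      by field; rewrite gt_eqF.
    rewrite ler_wpM2l ?ler_wpM2r// ?(ltW h_gt0)//.
    by rewrite !(mulr_ge0, invr_ge0)// ltW.
  - by apply: le_trans Nh; rewrite ler_wpM2r ?ler_nat// ltW.
  - have : h <= N%:R * h by rewrite ler_peMl ?ler1n// ltW.
    lra.
have lam_ge0 i : 0 <= lam i by rewrite exprn_ge0// sigma_ge0.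
apply: (@le_trans _ _ (s`!%:R ^+ 2 * (s%:R ^+ 2 / q%:R) ^+ s * \prod_i lam i)).
  rewrite -lecR rmorph_prod; under eq_bigr do rewrite rmorphXn.
  have -> : (s`!%:R ^+ 2 * (s%:R ^+ 2 / q%:R) ^+ s * \prod_i lam i)%:C =
      s`!%:R ^+ 2 * (s%:R ^+ 2 / q%:R) ^+ s * \prod_i (lam i)%:C :> R[i].
    by rewrite rmorphM rmorph_prod !(rmorphXn, rmorphM, fmorphV, rmorph_nat).
  apply: (vandermonde_gram_eigen_prod_ge (fun l => norm_expi (x l)) U_unitary UE) => //.
  - exact: leqW.
  - by rewrite lecR.
rewrite ler_wpM2r ?prodr_ge0// -mulrA ler_wpM2l ?exprn_ge0// -exprMn.
rewrite lerXn2r ?nnegrE ?mulr_ge0 ?invr_ge0 ?exprn_ge0//.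
rewrite ler_pdivrMr// mulrAC ler_pdivlMr//.
have -> : 2 * s%:R ^+ 3 * q%:R = s%:R ^+ 2 * (2 * q%:R * s%:R) :> R by ring.
by rewrite ler_wpM2l ?exprn_ge0.
Qed.

End Cluster.

(* Choice of the constants and conclusion *)
Local Close Scope complex_scope.
Local Close Scope sesquilinear_scope.
Unset Implicit Arguments.
Set Strict Implicit.
Set Printing Implicit Defensive.

Theorem theorem2p3 (R : realType) (s : nat) (s_gt0 : (0 < s)%N) :
  exists2 C11 : R, 0 < C11 &
  forall tau : R, 0 < tau ->
  exists C9 C10 : R, [/\ 0 < C9, 0 < C10 &
    forall (h : R) (x : 'I_s -> R), 0 < h -> is_cluster h tau x ->
    forall N : nat, (s <= N)%N -> N%:R * h <= C9 ->
    forall j : nat, (1 <= j <= s)%N ->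
      C10 * Num.sqrt N%:R * (N%:R * h) ^+ (j - 1)
        <= sigma j (vandermonde N x)
        <= C11 * Num.sqrt N%:R * (N%:R * h) ^+ (j - 1)].
Proof.
have s0 : 0 < s%:R :> R by rewrite ltr0n.
(* With N + 1 <= 2 N the upper bound on the squares has constant 2 s^4, at most the square of 2 s^2;
   tau does not enter. *)
exists (2 * s%:R ^+ 2); first by rewrite mulr_gt0// exprn_gt0.
move=> tau tau_gt0.
pose rho : R := cos 1 * tau / (4 * s%:R).
have rho_gt0 : 0 < rho by rewrite divr_gt0 ?mulr_gt0// cos1_gt0.
pose a : R := 2 * s%:R ^+ 4.
have a_gt0 : 0 < a by rewrite mulr_gt0// exprn_gt0.
pose b : R := s`!%:R ^+ 2 * (2 * s%:R ^+ 3) ^+ s.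
have b_gt0 : 0 < b.
  by rewrite mulr_gt0 ?exprn_gt0 ?mulr_gt0 ?exprn_gt0// ltr0n fact_gt0.
pose c : R := (\prod_(i < s) rho ^+ (2 * i)) / (b * a ^+ s.-1).
have c_gt0 : 0 < c.
  apply: divr_gt0; last by rewrite mulr_gt0 ?exprn_gt0.
  by apply: prodr_gt0 => i _; rewrite exprn_gt0.
(* The bound N h <= 1/2 keeps q-fold angles small enough for [norm_expr_sub1_ge]. The lower estimate
   concerns squares, hence the root of [c]. *)
exists 2^-1, (Num.sqrt c); split; rewrite ?sqrtr_gt0// ?invr_gt0//.
move=> h x h_gt0 x_cluster N sN Nh [//|j] /andP[_ js]; rewrite subn1/=.
have N_gt0 : (0 < N)%N by apply: leq_trans sN.
have N0 : 0 < N%:R :> R by rewrite ltr0n.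
have eta_gt0 : 0 < N%:R * h by rewrite mulr_gt0.
pose lam (i : 'I_s) := sigma i.+1 (vandermonde N x) ^+ 2.
have lam_ge0 i : 0 <= lam i by rewrite exprn_ge0// sigma_ge0.
have lam_le i : lam i <= a * N%:R * (N%:R * h) ^+ (2 * i).
  apply: (le_trans (cluster_sigma_sqr_le x_cluster h_gt0 s_gt0 N i)).
  rewrite ler_wpM2r ?exprn_ge0 ?(ltW eta_gt0)// /a mulrAC ler_wpM2r ?exprn_ge0//.
  by rewrite -natrM ler_nat mul2n -addnn -addn1 leq_add2l.
have prod_le := cluster_sigma_sqr_prod_ge x_cluster h_gt0 s_gt0 sN tau_gt0 Nh.
have := prod_le_factor_ge (Ordinal js) a_gt0 b_gt0 rho_gt0 eta_gt0 N0 lam_ge0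
  lam_le prod_le.
have := lam_le (Ordinal js).
rewrite -/c /lam/= => lam_j_le lam_j_ge.
have eta_ge0 := ltW eta_gt0.
have sqrE d : (d * Num.sqrt N%:R * (N%:R * h) ^+ j) ^+ 2 =
    d ^+ 2 * N%:R * (N%:R * h) ^+ (2 * j).
  by rewrite exprMn exprMn sqr_sqrtr ?(ltW N0)// -exprM mulnC.
apply/andP; split; rewrite -(@ler_pXn2r _ 2) ?nnegrE ?sigma_ge0//;
  rewrite ?mulr_ge0 ?sqrtr_ge0 ?exprn_ge0// sqrE.
  by rewrite sqr_sqrtr ?(ltW c_gt0).
apply: (le_trans lam_j_le); rewrite ler_wpM2r ?exprn_ge0// ler_wpM2r//.
rewrite /a exprMn -exprM ler_wpM2r ?exprn_ge0//.
by rewrite -natrX ler_nat.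
Qed.
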